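(* For every integer $n\geqslant 0$, the number of maximal chains in the poset $\Sigma_n C_1^n$ (the stacking of the hypercubes $C_1^0\to C_1^1\to\dots\to C_1^n$) equals the odd double factorial $(2n-1)!!=\frac{(2n)!}{2^n n!}$, with the convention $(-1)!!=1$.
   Context: For $m\geqslant 0$, $C_m$ denotes the chain $\{0<1<\dots<m\}$ with $m+1$ elements, and $C_m^n$ its $n$-th cartesian power with the componentwise order (so $C_1^n$ is the $n$-dimensional cube, and $C_m^0$ is a one-element poset). The maps $C_m^i\to C_m^{i+1}$ used for stacking are the embeddings $(x_1,\dots,x_i)\mapsto(0,x_1,\dots,x_i)$. Stacking (lax sum): given posets $M_0,\dots,M_n$ and monotone maps $f_j\colon M_j\to M_{j+1}$ ($0\leqslant j<n$), the poset $\Sigma_nM_n$ has as elements the pairs $(x,j)$ with $0\leqslant j\leqslant n$ and $x\in M_j$ (disjoint union), ordered by $(x,j)\leqslant(y,k)$ if and only if $j\leqslant k$ and $(f_{k-1}\circ\dots\circ f_j)(x)\leqslant y$ in $M_k$ (where for $j=k$ the composite is the identity). $\Sigma_nC_1^n$ denotes this construction applied to $C_1^0\to C_1^1\to\dots\to C_1^n$. *)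

(* Defs.v *)
From HB Require Import structures.
From mathcomp Require Import all_boot all_order all_algebra.

Set Implicit Arguments.
Unset Strict Implicit.
Unset Printing Implicit Defensive.

Import Order.Theory.

Section Chains.
Context {d : Order.disp_t} {T : finPOrderType d}.

Definition is_chain (A : {set T}) : bool :=
  [forall x in A, forall y in A, (x >=< y)%O].

Definition maximal_chains : {set {set T}} := [set A | maxset is_chain A].

End Chains.

Arguments maximal_chains {d} T.

Section Stacking.
Context {d : Order.disp_t} (M : nat -> finPOrderType d).
Variable f : forall j, {omorphism M j -> M j.+1}.

Fixpoint stack_iter (j k : nat) : M j -> M (k + j) :=
  if k is k'.+1 then fun x => f (k' + j) (stack_iter k' x) else id.

(* f_(k-1) \o ... \o f_j *)
Definition stack_comp (j k : nat) (jk : j <= k) (x : M j) : M k :=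
  ecast i (M i) (subnK jk) (stack_iter (k - j) x).

(* The posets M_j with j > n, and the maps f_j with j >= n, play no role.    *)
(* The phantom argument f lets the order below be canonical on stacking f n. *)
Definition stacking of (forall j, {omorphism M j -> M j.+1}) :=
  fun n : nat => {j : 'I_n.+1 & M j}.

HB.instance Definition _ n := Finite.on (stacking f n).

Definition stacking_le (n : nat) : rel (stacking f n) := fun u v =>
  if @idP (tag u <= tag v) is ReflectT jk
  then (stack_comp jk (tagged u) <= tagged v)%O else false.

Lemma stacking_leP n (u v : stacking f n) :
  reflect (exists jk : tag u <= tag v,
             (stack_comp jk (tagged u) <= tagged v)%O)
          (stacking_le u v).
Proof.
rewrite /stacking_le; case: {-}_ / idP => [jk|njk].
  apply: (iffP idP) => [le_uv|[jk']]; first by exists jk.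
  by rewrite (bool_irrelevance jk' jk).
by apply: ReflectF => -[jk _]; apply: njk.
Qed.

Lemma stack_comp_id j (jj : j <= j) (x : M j) : stack_comp jj x = x.
Proof.
rewrite /stack_comp; move: (subnK jj); rewrite subnn => e.
by rewrite (eq_axiomK e).
Qed.

Lemma stack_compS j k (jk : j <= k) (jk1 : j <= k.+1) (x : M j) :
  stack_comp jk1 x = f k (stack_comp jk x).
Proof.
rewrite /stack_comp; move: (subnK jk1) (subnK jk); rewrite (subSn jk).
move: (k - j) => m e1 e2; case: k / e2 {jk jk1} e1 => e1.
by rewrite (eq_axiomK e1).
Qed.

Lemma stack_comp_comp i j k (ij : i <= j) (jk : j <= k) (ik : i <= k) x :
  stack_comp jk (stack_comp ij x) = stack_comp ik x.
Proof.
elim: k jk ik => [|k IHk] jk ik.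
  case: j ij jk => [|//] ij jk; rewrite stack_comp_id.
  by rewrite (bool_irrelevance ij ik).
have [ejk|ltjk] := eqVneq j k.+1.
  by case: k.+1 / ejk jk ik => jk ik; rewrite stack_comp_id (bool_irrelevance ij ik).
have jk' : j <= k by move: jk; rewrite leq_eqVlt (negPf ltjk).
by rewrite (stack_compS jk') (stack_compS (leq_trans ij jk')) -IHk.
Qed.

Lemma stack_comp_mono j k (jk : j <= k) :
  {homo @stack_comp j k jk : x y / (x <= y)%O}.
Proof.
move=> x y lexy; rewrite /stack_comp; move: (subnK jk); move: (k - j) => l e.
by case: k / e {jk}; elim: l => //= m IHm; apply: omorph_le.
Qed.

Lemma stacking_le_refl n : reflexive (@stacking_le n).
Proof.
by move=> u; apply/stacking_leP; exists (leqnn _); rewrite stack_comp_id.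
Qed.

Lemma stacking_le_anti n : antisymmetric (@stacking_le n).
Proof.
move=> [j x] [k y] /andP[/stacking_leP[/= jk lexy] /stacking_leP[/= kj leyx]].
have ejk : j = k by apply/val_inj/anti_leq; rewrite jk.
case: k / ejk => /= in y jk kj lexy leyx *.
move: lexy leyx; rewrite !stack_comp_id => lexy leyx.
by congr existT; apply: le_anti; rewrite lexy.
Qed.

Lemma stacking_le_trans n : transitive (@stacking_le n).
Proof.
move=> v u w /stacking_leP[uv leuv] /stacking_leP[vw levw].
apply/stacking_leP; exists (leq_trans uv vw); rewrite -(stack_comp_comp uv vw).
exact: le_trans (stack_comp_mono _ leuv) levw.
Qed.

HB.instance Definition _ n :=
  Order.Le_isPOrder.Build d (stacking f n)
    (@stacking_le_refl n) (@stacking_le_anti n) (@stacking_le_trans n).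

End Stacking.

Definition chain_power (m n : nat) : finPOrderType _ := n.-tupleprod 'I_m.+1.

Definition chain_power_emb (m i : nat) (x : chain_power m i) :
  chain_power m i.+1 := [tuple of ord0 :: x].

Lemma chain_power_emb_mono m i :
  {homo @chain_power_emb m i : x y / (x <= y)%O}.
Proof.
move=> x y; rewrite !leEtprod => /forallP lexy; apply/forallP => j.
by case: (unliftP ord0 j) => [k|] ->; rewrite ?tnthS ?tnth0.
Qed.

HB.instance Definition _ m i :=
  Order.isOrderMorphism.Build _ (chain_power m i) _ (chain_power m i.+1)
    (@chain_power_emb m i) (@chain_power_emb_mono m i).

Definition stacked_cubes (n : nat) : finPOrderType _ :=
  stacking (fun j => @chain_power_emb 1 j : {omorphism _ -> _}) n.

(* (2n-1)!! = 1 * 3 * ... * (2n-1), the empty product for n = 0. *)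
Definition odd_double_factorial (n : nat) : nat := \prod_(i < n) (2 * i + 1).

(* Main.v *)
Require Import Defs.
From mathcomp Require Import all_boot all_order all_algebra.
From mathcomp Require Import zify.

(** A point of the stacked cubes is a level [j] together with a set [S] of
    coordinates below [j], and the order is componentwise.  The covers of
    [(j, S)] are [(j + 1, S)] and the [z = j - #|S|] points [(j, i |: S)].
    In a finite poset, the maximal chains above a non-maximal [x] are
    distributed among the covers of [x], so the number [N] of maximal chains
    above [(j, S)] depends only on [z] and [k = n - j], with
    [N(z, k) = N(z + 1, k - 1) + z * N(z - 1, k)].  Hence
    [N(z, k) * 2^k * k! = (2k + z)!]; the bottom is the case [z = 0], [k = n]. *)

Set Implicit Arguments.
Unset Strict Implicit.
Unset Printing Implicit Defensive.

Import Order.Theory GRing.Theory Num.Theory.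

(** * Maximal chains above a point of a finite poset, and its covers *)

Section ChainsAbove.
Context {d : Order.disp_t} {T : finPOrderType d}.
Implicit Types (x y z w : T) (A B : {set T}).

Definition covers x y : bool := (x < y)%O && [forall z, ~~ (x < z < y)%O].

Definition chain_above x A : bool := is_chain A && [forall w in A, (x <= w)%O].

Definition maximal_chains_above x : {set {set T}} :=
  [set A | maxset (chain_above x) A].

Lemma coversP x y :
  reflect ((x < y)%O /\ forall z, (x < z)%O -> (z < y)%O -> False) (covers x y).
Proof.
apply: (iffP andP) => -[xy H]; split=> //.
  by move=> z xz zy; move/forallP/(_ z): H; rewrite xz zy.
by apply/forallP=> z; apply/negP=> /andP[/H].
Qed.

Lemma is_chainP A :
  reflect {in A &, forall x y, (x >=< y)%O} (is_chain A).
Proof.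
apply: (iffP forall_inP) => [H x y xA yA|H x xA].
  by move/forall_inP: (H x xA); apply.
by apply/forall_inP => y; apply: H.
Qed.

Lemma chain_aboveP x A :
  reflect (is_chain A /\ {in A, forall w, (x <= w)%O}) (chain_above x A).
Proof.
by apply: (iffP andP) => -[cA H]; split => //; apply/forall_inP.
Qed.

Lemma chain_setU1 x A :
  is_chain A -> {in A, forall w, (x >=< w)%O} -> is_chain (x |: A).
Proof.
move=> /is_chainP cA xA; apply/is_chainP => u v /setU1P[->|uA] /setU1P[->|vA].
- exact: comparablexx.
- exact: xA.
- by rewrite comparable_sym xA.
- exact: cA.
Qed.

Lemma chain_sub A B : A \subset B -> is_chain B -> is_chain A.
Proof.
move=> /subsetP AB /is_chainP cB; apply/is_chainP => u v uA vA.
by apply: cB; apply: AB.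
Qed.

Lemma chain_above_setU1 x A : chain_above x A -> chain_above x (x |: A).
Proof.
move=> /chain_aboveP[cA xA]; apply/chain_aboveP; split.
  by apply: chain_setU1 => // w /xA xw; rewrite /Order.comparable xw.
by move=> w /setU1P[->|/xA].
Qed.

(** Maximality can be tested one element at a time: a [z] above [x] and comparable to all of [A]
    extends [A] to a chain above [x], and every element of a larger such chain is of this kind. *)
Lemma maximal_chain_aboveP x A :
  reflect [/\ chain_above x A &
            forall z, (x <= z)%O -> {in A, forall w, (z >=< w)%O} -> z \in A]
          (A \in maximal_chains_above x).
Proof.
rewrite inE; apply: (iffP maxsetP) => -[cA mA]; split=> //.
  move=> z xz zA; rewrite -[in X in _ \in X](mA (z |: A)) ?setU11 ?subsetUr //.
  case/chain_aboveP: cA => cA xA; apply/chain_aboveP; split.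
    exact: chain_setU1.
  by move=> w /setU1P[->|/xA].
move=> B /chain_aboveP[/is_chainP cB xB] AB; apply/eqP.
rewrite eqEsubset AB andbT; apply/subsetP=> z zB; apply: mA; first exact: xB.
by move=> w wA; apply: cB => //; apply: (subsetP AB).
Qed.

Lemma mem_maximal_chain_above x A : A \in maximal_chains_above x -> x \in A.
Proof.
case/maximal_chain_aboveP=> /chain_aboveP[_ xA]; apply=> // w /xA xw.
by rewrite /Order.comparable xw.
Qed.

Lemma maximal_chains_bottom x :
  (forall y, (x <= y)%O) -> maximal_chains T = maximal_chains_above x.
Proof.
move=> xT; apply/setP=> A; rewrite !inE; apply: maxset_eq => B.
by rewrite /chain_above; case: is_chain => //=; symmetry; apply/forall_inP.
Qed.

Lemma maximal_chains_above_maximal x :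
  (forall y, ~~ (x < y)%O) -> maximal_chains_above x = [set [set x]].
Proof.
move=> xmax; have eqx w : (x <= w)%O -> w = x.
  by rewrite le_eqVlt (negPf (xmax w)) orbF => /eqP.
apply/setP => A; rewrite in_set1; apply/idP/eqP => [mA|->].
  have xA := mem_maximal_chain_above mA.
  case/maximal_chain_aboveP: mA => /chain_aboveP[_ ge_x] _.
  apply/setP => w; rewrite in_set1; apply/idP/eqP => [/ge_x/eqx //|->//].
apply/maximal_chain_aboveP; split=> [|z /eqx ->]; last by rewrite set11.
apply/chain_aboveP; split=> [|w /set1P-> //].
by apply/is_chainP=> u v /set1P-> /set1P->; apply: comparablexx.
Qed.

(** The cover is the least element of [A] strictly above [x]: anything strictly between the two
    would be comparable to all of [A], hence in [A] by maximality. The point [z] only witnesses that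
    [x] is not maximal. *)
Lemma maximal_chain_cover x A z :
    A \in maximal_chains_above x -> (x < z)%O ->
  exists2 y, y \in A & covers x y.
Proof.
move=> mA xz; have xA := mem_maximal_chain_above mA.
case/maximal_chain_aboveP: mA => /chain_aboveP[/is_chainP cA geA] maxA.
have [y0 y0A xy0] : exists2 y, y \in A & (x < y)%O.
  case: (pickP (fun y => (y \in A) && (x < y)%O)) => [y /andP[]|noy].
    by exists y.
  (* Without elements above [x], [A] would reduce to [x] and could be extended by [z]. *)
  have zA : z \in A.
    apply: maxA => [|w wA]; first exact: ltW.
    have := noy w; rewrite wA lt_neqAle geA //= andbT => /negbFE/eqP <-.
    by rewrite /Order.comparable (ltW xz) orbT.
  by have := noy z; rewrite zA xz.
pose P y := (y \in A) && (x < y)%O; have Py0 : P y0 by rewrite /P y0A.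
(* In a chain, a smaller element has a strictly smaller down-set, so minimising the size of the
   down-set finds the least element. *)
case: (arg_minnP (fun y => #|[set w | (w <= y)%O]|) Py0) => y /andP[yA xy] ymin.
exists y => //; apply/coversP; split=> // t xt ty.
have min w : w \in A -> (x < w)%O -> (y <= w)%O.
  move=> wA xw; have /orP[//|wy] := cA y w yA wA.
  rewrite le_eqVlt; case: eqVneq => //= yw.
  suff: #|[set v | (v <= w)%O]| < #|[set v | (v <= y)%O]|.
    by rewrite ltnNge ymin // /P wA.
  apply/proper_card/properP; split.
    by apply/subsetP => v; rewrite !inE => /le_trans; apply.
  exists y; rewrite !inE ?lexx //; apply: contraNN yw => yw.
  by rewrite eq_le yw.
have tA : t \in A.
  apply: maxA => [|w wA]; first exact: ltW.
  have := geA w wA; rewrite le_eqVlt => /orP[/eqP<-|/(min w wA)].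
    by rewrite /Order.comparable (ltW xt) orbT.
  by move/(lt_le_trans ty)/ltW => tw; rewrite /Order.comparable tw.
by have /le_gtF := min t tA xt; rewrite ty.
Qed.

Lemma covers_chain_uniq x y y' :
  covers x y -> covers x y' -> (y >=< y')%O -> y = y'.
Proof.
move=> /coversP[xy cy] /coversP[xy' cy'].
by case: comparableP => // [/(cy' _ xy)|/(cy _ xy')].
Qed.

Lemma covers_chain_le x y A :
    covers x y -> chain_above x A -> y \in A ->
  {in A :\ x, forall w, (y <= w)%O}.
Proof.
move=> /coversP[xy cy] /chain_aboveP[/is_chainP cA geA] yA w /setD1P[wx wA].
have := cA y w yA wA; case: comparableP => // wy _.
by case: (cy w _ wy); rewrite lt_neqAle eq_sym wx geA.
Qed.

(** Adding and removing [x] are inverse to each other. In a chain above [x] that contains the cover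
    [y], everything except [x] is above [y], so removing [x] leaves a chain above [y], and
    maximality passes both ways. *)
Lemma maximal_chains_above_cover x y :
    covers x y ->
  [set A in maximal_chains_above x | y \in A]
    = [set x |: B | B in maximal_chains_above y].
Proof.
move=> cxy; have /coversP[xy _] := cxy.
apply/setP => A; apply/idP/imsetP => [|[B mB ->]].
  rewrite inE => /andP[mA yA]; have xA := mem_maximal_chain_above mA.
  case/maximal_chain_aboveP: mA => caA maxA.
  exists (A :\ x); last by rewrite setD1K.
  have geA := covers_chain_le cxy caA yA.
  apply/maximal_chain_aboveP; split.
    apply/chain_aboveP; split=> //.
    by case/chain_aboveP: caA => cA _; apply: chain_sub cA; apply: subsetDl.
  move=> z yz zA; have xz := lt_le_trans xy yz.
  rewrite in_setD1 (gt_eqF xz) /=; apply: maxA => [|w wA]; first exact: ltW.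
  have [->|wx] := eqVneq w x; last by apply: zA; rewrite in_setD1 wx.
  by rewrite /Order.comparable (ltW xz) orbT.
have yB := mem_maximal_chain_above mB.
case/maximal_chain_aboveP: mB => caB maxB.
have caxB : chain_above x (x |: B).
  apply: chain_above_setU1; case/chain_aboveP: caB => cB geB.
  apply/chain_aboveP; split=> // w /geB; apply: le_trans; exact: ltW.
rewrite inE in_setU1 yB orbT andbT; apply/maximal_chain_aboveP; split=> //.
move=> z xz zxB; rewrite in_setU1; case: eqVneq => //= zx.
apply: maxB => [|w wB]; last by apply: zxB; rewrite in_setU1 wB orbT.
(* That [z] lies above [y] is read off from the chain already enlarged by [z]. *)
apply: (covers_chain_le (A := z |: (x |: B)) cxy).
- case/chain_aboveP: caxB => cxB geB; apply/chain_aboveP; split.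
    exact: chain_setU1.
  by move=> w /setU1P[->|/geB].
- by rewrite !inE yB !orbT.
- by rewrite !inE zx eqxx.
Qed.

(** A maximal chain above a non-maximal [x] contains exactly one cover of [x]: one exists, and two
    comparable covers coincide. Summing over that cover and exchanging the sums gives the
    recursion. *)
Lemma card_maximal_chains_above x z :
    (x < z)%O ->
  #|maximal_chains_above x|
    = \sum_(y | covers x y) #|maximal_chains_above y|.
Proof.
move=> xz; rewrite -sum1_card.
transitivity (\sum_(A in maximal_chains_above x)
                \sum_(y | covers x y && (y \in A)) 1).
  apply: eq_bigr => A mA.
  have [y yA cxy] := maximal_chain_cover mA xz.
  rewrite (big_pred1 y) // => y' /=; apply/andP/eqP => [[cxy' y'A]|-> //].
  apply: covers_chain_uniq cxy' cxy _.
  case/maximal_chain_aboveP: mA => /chain_aboveP[/is_chainP cA _] _.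
  exact: cA.
rewrite (exchange_big_dep (covers x)) /=; last by move=> A y _ /andP[].
apply: eq_bigr => y cxy; have /coversP[xy _] := cxy.
(* Adding [x] is injective on the chains above [y], since none of them contains [x]. *)
rewrite -[RHS](@card_in_imset _ _ (fun B => x |: B)).
  rewrite -maximal_chains_above_cover // -sum1_card.
  by apply: eq_bigl => A; rewrite !inE cxy.
have xB B : B \in maximal_chains_above y -> x \notin B.
  case/maximal_chain_aboveP=> /chain_aboveP[_ geB] _.
  by apply/negP => /geB/le_gtF; rewrite xy.
by move=> B B' /xB xB1 /xB xB2 e; rewrite -(setU1K xB1) e setU1K.
Qed.

End ChainsAbove.

(** * The order of the stacked cubes in terms of levels and supports *)

Lemma val_stack_comp (j k : nat) (jk : j <= k) (x : chain_power 1 j) :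
  stack_comp (fun i => @chain_power_emb 1 i : {omorphism _ -> _}) jk x
    = nseq (k - j) ord0 ++ (x : j.-tuple 'I_2) :> seq 'I_2.
Proof.
elim: k jk => [|k IHk] jk.
  by case: j jk x => [|//] jk x; rewrite stack_comp_id.
have [ejk|ltjk] := eqVneq (j : nat) k.+1.
  by case: k.+1 / ejk jk => jk; rewrite stack_comp_id subnn.
have jk' : j <= k by move: jk; rewrite leq_eqVlt (negPf ltjk).
by rewrite (stack_compS _ jk') subSn //= IHk.
Qed.

(** The default value [ord0] makes the inequality trivial beyond the length, so [i] needs no bound
    and points of different levels can be compared at the same index. *)
Lemma chain_power_le_rev m (k : nat) (x y : chain_power m k) :
  reflect (forall i : nat, nth ord0 (rev (x : k.-tuple 'I_m.+1)) i
                        <= nth ord0 (rev (y : k.-tuple 'I_m.+1)) i)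
          (x <= y)%O.
Proof.
rewrite leEtprod; apply: (iffP forallP) => lexy i.
  have [ik|ki] := ltnP i k; last by rewrite nth_default // size_rev size_tuple.
  rewrite !nth_rev ?size_tuple // -!(tnth_nth ord0 _ (rev_ord (Ordinal ik))).
  exact: lexy.
have := lexy (rev_ord i); rewrite !nth_rev ?size_tuple ?ltn_ord //.
by rewrite -!(tnth_nth ord0 _ (rev_ord (rev_ord i))) rev_ordK.
Qed.

Lemma ord2_leE (a b : 'I_2) : (a <= b) = ((a != ord0) ==> (b != ord0)).
Proof. by case: a b => [[|[|?]] ?] [[|[|?]] ?]. Qed.

Section StackedCubes.
Variable n : nat.
Implicit Types (u v : stacked_cubes n) (j : 'I_n.+1) (S : {set 'I_n}).

Definition level u : 'I_n.+1 := tag u.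

(* The embeddings prepend a zero, so coordinates are counted from the right to
   make them independent of the level. *)
Definition coord u (i : nat) : 'I_2 :=
  nth ord0 (rev (tagged u : (level u).-tuple 'I_2)) i.

Definition support u : {set 'I_n} := [set i : 'I_n | coord u i != ord0].

Lemma coord_over u (i : nat) : level u <= i -> coord u i = ord0.
Proof. by move=> ji; rewrite /coord nth_default // size_rev size_tuple. Qed.

Lemma level_ord j : j <= n. Proof. by rewrite -ltnS. Qed.


Lemma stacked_cubes_leE u v :
  (u <= v)%O = (level u <= level v) && (support u \subset support v).
Proof.
(* After reversal the prepended zeros come last, at indices where [coord u] already takes the
   default value zero. *)
have comp_coord (juv : level u <= level v) i :
    nth ord0 (rev (stack_comp
      (fun i => @chain_power_emb 1 i : {omorphism _ -> _})
      juv (tagged u) : (level v).-tuple 'I_2)) i = coord u i.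
  rewrite val_stack_comp rev_cat nth_cat size_rev size_tuple.
  case: ltnP => // ui; rewrite coord_over //.
  by rewrite rev_nseq nth_nseq if_same.
apply/stacking_leP/andP => [[juv /chain_power_le_rev le_uv]|[juv /subsetP suv]].
  split=> //; apply/subsetP => i; rewrite !inE.
  by have := le_uv i; rewrite comp_coord ord2_leE => /implyP.
exists juv; apply/chain_power_le_rev => i; rewrite comp_coord.
have [ui|iu] := leqP (level u) i; first by rewrite coord_over.
have ltin : i < n by apply: leq_trans iu (level_ord _).
by rewrite ord2_leE; apply/implyP; have := suv (Ordinal ltin); rewrite !inE.
Qed.

Definition below j : {set 'I_n} := [set i : 'I_n | i < j].

Lemma card_below j : #|below j| = j.
Proof.
rewrite -sum1dep_card -(big_ord_widen n (fun=> 1) (level_ord j)).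
by rewrite sum1_card card_ord.
Qed.

Lemma support_below u : support u \subset below (level u).
Proof.
apply/subsetP => i; rewrite !inE; apply: contraNT; rewrite -leqNgt => ui.
by rewrite coord_over.
Qed.

(** The [rev_tuple] cancels the reversal in [coord]. Elements of [S] outside [below j] are dropped,
    whence the hypothesis of [support_cube_point]. *)
Definition cube_point j S : stacked_cubes n :=
  Tagged (fun j : 'I_n.+1 => chain_power 1 j)
    (rev_tuple (mktuple (fun i : 'I_j =>
       if widen_ord (level_ord j) i \in S then ord_max else ord0 : 'I_2))).

Lemma support_cube_point j S :
  S \subset below j -> support (cube_point j S) = S.
Proof.
move=> /subsetP Sj; apply/setP => i; rewrite inE.
have [ij|ji] := ltnP i j; last first.
  rewrite coord_over // eqxx; symmetry; apply/negP => /Sj.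
  by rewrite inE ltnNge ji.
rewrite /coord /= revK (nth_map (Ordinal ij)) ?size_enum_ord //.
rewrite (_ : widen_ord _ _ = i); first by case: (i \in S).
by apply: val_inj; rewrite /= nth_enum_ord.
Qed.

Lemma stacked_cubes_ext u v : level u = level v -> support u = support v -> u = v.
Proof.
move=> eqj eqS; apply: le_anti.
by rewrite !stacked_cubes_leE eqj eqS leqnn subxx.
Qed.

(** * Rank and covers in the stacked cubes *)

Definition rank u : nat := level u + #|support u|.

Lemma ltn_rank u v : (u < v)%O -> rank u < rank v.
Proof.
rewrite lt_neqAle stacked_cubes_leE => /and3P[uv juv suv].
have := subset_leq_card suv; rewrite leq_eqVlt => /predU1P[es|]; last first.
  by rewrite /rank; lia.
move: juv; rewrite leq_eqVlt => /predU1P[ej|]; last by rewrite /rank; lia.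
case/eqP: uv; apply: stacked_cubes_ext; first exact: val_inj.
by apply/eqP; rewrite eqEcard suv es /=.
Qed.

(** This has at most one element; as a set it also covers the top level, where it is empty. *)
Definition raises u : {set stacked_cubes n} :=
  [set v | (level v == (level u).+1 :> nat) && (support v == support u)].

Definition flips u : {set stacked_cubes n} :=
  [set cube_point (level u) (i |: support u)
     | i in below (level u) :\: support u].

Lemma flip_below u i :
  i \in below (level u) :\: support u -> i |: support u \subset below (level u).
Proof.
by case/setDP=> iu _; rewrite subUset sub1set iu support_below.
Qed.

Lemma card_raises u : #|raises u| = (level u < n).
Proof.
have [ltjn|] := ltnP (level u) n; last first.
  move=> nj; apply: eq_card0 => v; rewrite inE; apply/negbTE/negP.
  case/andP=> /eqP ej _; have := level_ord (level v); rewrite ej; lia.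
have ltj1 : (level u).+1 < n.+1 by [].
have subS : support u \subset below (Ordinal ltj1).
  apply: subset_trans (support_below u) _.
  by apply/subsetP => i; rewrite !inE => /ltnW.
apply/eqP/cards1P; exists (cube_point (Ordinal ltj1) (support u)).
apply/setP => v; rewrite !inE; apply/andP/eqP => [[/eqP ej /eqP es]|->].
  by apply: stacked_cubes_ext; [exact: val_inj | rewrite support_cube_point].
by rewrite support_cube_point.
Qed.

Lemma card_flips u : #|flips u| = level u - #|support u|.
Proof.
rewrite card_in_imset => [|i i' Di Di'].
  by rewrite cardsD (setIidPr (support_below u)) card_below.
move/(congr1 support); rewrite !support_cube_point ?flip_below // => e.
have /setDP[_ iu] := Di.
by have := setU11 i (support u); rewrite e in_setU1 (negPf iu) orbF => /eqP.
Qed.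

Lemma raisesP u v : v \in raises u -> (u < v)%O /\ rank v = (rank u).+1.
Proof.
rewrite inE => /andP[/eqP ej /eqP es]; rewrite /rank ej es; split=> //.
rewrite lt_neqAle stacked_cubes_leE ej es subxx leqnSn !andbT.
by apply/eqP => e; move: ej; rewrite e; lia.
Qed.

Lemma flipsP u v :
  v \in flips u -> [/\ (u < v)%O, rank v = (rank u).+1 & level v = level u].
Proof.
case/imsetP=> i Di ->; have /setDP[_ iu] := Di.
have rk : rank (cube_point (level u) (i |: support u)) = (rank u).+1.
  by rewrite /rank support_cube_point ?flip_below // cardsU1 iu addnCA.
split=> //; rewrite lt_neqAle stacked_cubes_leE support_cube_point ?flip_below //.
rewrite leqnn subsetUr !andbT; apply/eqP => e; move: rk; rewrite -e; lia.
Qed.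

(** If [support v] has a new coordinate below [level u], flip it. Otherwise equal levels would force
    [u = v], so [v] lies on a higher level and [u] can be raised. *)
Lemma raise_or_flip u v :
  (u < v)%O -> exists2 w, w \in raises u :|: flips u & (w <= v)%O.
Proof.
move=> uv; have := ltW uv; rewrite stacked_cubes_leE => /andP[juv suv].
case: (pickP [pred i in below (level u) :\: support u | i \in support v]).
  move=> i /andP[/= Di iv]; exists (cube_point (level u) (i |: support u)).
    by apply/setUP; right; apply: imset_f.
  rewrite stacked_cubes_leE juv support_cube_point ?flip_below //.
  by rewrite subUset sub1set iv suv.
move=> noi; have [ltuv|] := ltnP (level u) (level v); last first.
  move=> jvu; have ej : level u = level v by apply/val_inj/anti_leq; rewrite juv.
  suff e : u = v by rewrite e ltxx in uv.
  apply: stacked_cubes_ext => //; apply/eqP; rewrite eqEsubset suv.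
  apply/subsetP => i iv; have := noi i; rewrite /= in_setD iv andbT.
  by rewrite ej (subsetP (support_below v)) // andbT => /negbFE.
have : 0 < #|raises u|.
  by rewrite card_raises lt0b; have := level_ord (level v); lia.
case/card_gt0P => w wu; exists w; first by rewrite inE wu.
move: wu; rewrite inE => /andP[/eqP ej /eqP es].
by rewrite stacked_cubes_leE ej es ltuv.
Qed.

(** A raise or flip increases the rank by exactly one, so nothing fits in between. Conversely, a
    cover [v] must equal the raise or flip that [raise_or_flip] finds below it. *)
Lemma coversE u v : covers u v = (v \in raises u :|: flips u).
Proof.
apply/coversP/setUP => [[uv cuv]|].
  have [w wu wv] := raise_or_flip uv; apply/setUP.
  move: wv; rewrite le_eqVlt => /predU1P[<- //|wv].
  by case: (cuv w) => //; case/setUP: wu => [/raisesP[]|/flipsP[]].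
have step : (u < v)%O /\ rank v = (rank u).+1 ->
    (u < v)%O /\ (forall w, (u < w)%O -> (w < v)%O -> False).
  by move=> [uv rk]; split=> // w /ltn_rank uw /ltn_rank; lia.
by case=> [/raisesP|/flipsP[]]; [|move=> *]; apply: step.
Qed.

(** * Counting the maximal chains *)

Definition zeros u : nat := level u - #|support u|.

Lemma support_le_level u : #|support u| <= level u.
Proof. by rewrite -(card_below (level u)) subset_leq_card ?support_below. Qed.

Lemma card_maximal_chains_above_cubes u :
  #|maximal_chains_above u| * (2 ^ (n - level u) * (n - level u)`!)
    = (2 * (n - level u) + zeros u)`!.
Proof.
(* Induction on the corank, which by [rkE] is the argument [2 * k + z] of the factorial. *)
have [m] := ubnP (2 * n - rank u); elim: m u => // m IHm u rk.
have jn := level_ord (level u); have sj := support_le_level u.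
set k := n - level u; set z := zeros u.
have rkE v : 2 * (n - level v) + zeros v = 2 * n - rank v.
  have := level_ord (level v); have := support_le_level v.
  by rewrite /zeros /rank; lia.
(* In the zero case [u] has the largest possible rank [2 * n], so it is maximal. *)
have [kz|kz] := posnP (2 * k + z).
  have [-> ->] : k = 0 /\ z = 0 by lia.
  rewrite maximal_chains_above_maximal ?cards1 // => v.
  apply/negP => /ltn_rank; have := level_ord (level v).
  by have := support_le_level v; move: kz; rewrite rkE /rank; lia.
have [v uv] : exists v, (u < v)%O.
  have : 0 < #|raises u| + #|flips u|.
    by rewrite card_raises card_flips -/(zeros u) -/z; case: ltnP; lia.
  rewrite addn_gt0 => /orP[]/card_gt0P[v vu]; exists v.
    by case/raisesP: vu.
  by case/flipsP: vu.
rewrite (card_maximal_chains_above uv).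
rewrite (eq_bigl [in [predU raises u & flips u]]); last first.
  by move=> w; rewrite coversE !inE.
rewrite bigU /=; last first.
  rewrite disjoint_subset; apply/subsetP => w; rewrite !inE => /andP[/eqP ej _].
  by apply/negP => /flipsP[_ _ e]; move: ej; rewrite e; lia.
have lt_m w : rank w = (rank u).+1 -> 2 * n - rank w < m.
  by move: kz; rewrite rkE; lia.
rewrite mulnDl !big_distrl /=.
(* The first summand will be the contribution of the raise, the second that of the [z] flips. *)
have -> : (2 * k + z)`! = (2 * k) * (2 * k + z).-1`! + z * (2 * k + z).-1`!.
  by rewrite -mulnDl -[in LHS](prednK kz) factS prednK.
congr (_ + _).
  rewrite (eq_bigr (fun=> (2 * k) * (2 * k + z).-1`!)) => [|w wu].
    (* On the top level there is no raise, and the expected term vanishes as well because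
       [k = 0]. *)
    rewrite sum_nat_const card_raises; have [ltjn|] := ltnP; rewrite ?mul1n //.
    by rewrite mul0n /k => nj; rewrite (_ : n - _ = 0) //; lia.
  have [uw rw] := raisesP wu; have IHw := IHm w (lt_m w rw).
  have lev : level w = (level u).+1 :> nat by move: wu; rewrite inE => /andP[/eqP].
  have jwn := level_ord (level w).
  (* The raise lowers [k] by one and increases [z] by one; the factor [2 * k] is what [2 ^ k * k!]
     loses in passing to [k - 1]. *)
  rewrite (_ : k = (n - level w).+1); last by rewrite /k; lia.
  rewrite factS expnS (_ : (_ + z).-1 = 2 * (n - level w) + zeros w); last first.
    by move: (rkE w) (rkE u); rewrite -/k -/z /k; lia.
  by rewrite -IHw mulnACA mulnCA.
rewrite (eq_bigr (fun=> (2 * k + z).-1`!)) => [|w /flipsP[uw rw lw]].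
  by rewrite sum_nat_const card_flips.
(* A flip keeps [k] and lowers [z] by one, so the induction hypothesis applies with the same factor
   [2 ^ k * k!]. *)
rewrite /k -lw IHm; last exact: lt_m.
by congr (_`!); move: (rkE w) (rkE u); rewrite lw -/z; lia.
Qed.

Definition cube_bottom : stacked_cubes n := cube_point ord0 set0.

Lemma support_cube_bottom : support cube_bottom = set0.
Proof. by rewrite support_cube_point ?sub0set. Qed.

Lemma cube_bottom_le u : (cube_bottom <= u)%O.
Proof. by rewrite stacked_cubes_leE support_cube_bottom sub0set. Qed.

Lemma card_maximal_chains_cubes :
  #|maximal_chains (stacked_cubes n)| * (2 ^ n * n`!) = (2 * n)`!.
Proof.
rewrite (maximal_chains_bottom cube_bottom_le).
have := card_maximal_chains_above_cubes cube_bottom.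
by rewrite /zeros /= subn0 sub0n addn0.
Qed.

End StackedCubes.

(** In the step from [n] to [n + 1] the right side gains [(2n + 2)(2n + 1)]: the even factor
    [2(n + 1)] is absorbed by [2 ^ n * n!], the odd one by the double factorial. *)
Lemma odd_double_factorialE n :
  odd_double_factorial n * (2 ^ n * n`!) = (2 * n)`!.
Proof.
elim: n => [|n IHn]; first by rewrite /odd_double_factorial big_ord0.
have e : 2 * n.+1 = (2 * n).+2 by rewrite mulnS.
rewrite e !factS -IHn /odd_double_factorial big_ord_recr /=.
by rewrite expnS [2 * 2 ^ n * _]mulnACA e addn1 -mulnA mulnCA [X in _ * X]mulnCA mulnCA.
Qed.

Theorem theorem1p1 (n : nat) :
  #|maximal_chains (stacked_cubes n)| = odd_double_factorial n
  /\ ((odd_double_factorial n)%:R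
      = (2 * n)`!%:R / (2 ^ n * n`!)%N%:R :> rat)%R.
Proof.
have pos : 0 < 2 ^ n * n`! by rewrite muln_gt0 expn_gt0 fact_gt0.
split.
  apply/eqP; rewrite -(eqn_pmul2r pos) odd_double_factorialE.
  by rewrite card_maximal_chains_cubes.
by rewrite -odd_double_factorialE natrM mulfK // pnatr_eq0 -lt0n.
Qed.
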